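(* Let $a,b\ge0$ be real and $(\lambda_0,\lambda_1,\lambda_2,\lambda_3)=(a,-a,-b,b)$. Then for all $n\ge 3$, all $t_1<t_2<\dots<t_n$ and all $j=2,\dots,n-1$, $$R_{j,j-1}+R_{j,j+1}\le\tfrac12R_{j,j}.$$
   Context: For $(\mu_0,\dots,\mu_N)\in\mathbb{C}^{N+1}$ let $\Phi_{(\mu_0,\dots,\mu_N)}$ (the fundamental function) be the unique solution of $\prod_{j=0}^N(\frac{d}{dx}-\mu_j)\Phi=0$ on $\mathbb{R}$ with $\Phi^{(k)}(0)=0$ for $k=0,\dots,N-1$ and $\Phi^{(N)}(0)=1$. Define for $x\ne0$ (for real exponents the denominators vanish only at $0$) $$\rho(x)=\frac{\Phi'_{(\lambda_0,\dots,\lambda_3)}(x)\Phi_{(\lambda_0,\lambda_1)}(x)-\Phi_{(\lambda_0,\dots,\lambda_3)}(x)\Phi'_{(\lambda_0,\lambda_1)}(x)}{\Phi_{(\lambda_0,\lambda_1)}(x)\Phi_{(\lambda_2,\lambda_3)}(x)},\qquad \sigma(x)=\frac{\Phi_{(\lambda_0,\dots,\lambda_3)}(x)}{\Phi_{(\lambda_0,\lambda_1)}(x)\Phi_{(\lambda_2,\lambda_3)}(x)}.$$ For $t_1<\dots<t_n$ and $j=2,\dots,n-1$ the entries of the tridiagonal matrix $R$ are $$R_{j,j}=\rho(t_j-t_{j-1})-\rho(-(t_{j+1}-t_j)),\quad R_{j,j+1}=\sigma(t_{j+1}-t_j),\quad R_{j,j-1}=-\sigma(-(t_j-t_{j-1})).$$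 (The $(n-2)\times(n-2)$ matrix is $R=(R_{i,j})_{2\le i,j\le n-1}$; the numbers $R_{2,1}$ and $R_{n-1,n}$ are also defined by these formulas.) *)

(* Defs.v *)
From Stdlib Require Import Reals List Arith ClassicalEpsilon.
From Coquelicot Require Import Coquelicot.
Import ListNotations.
Open Scope R_scope.

Definition diff_op (mu : list R) (f : R -> R) : R -> R :=
  fold_right (fun m g x => Derive g x - m * g x) f mu.

(* The list mu = [mu_0; ...; mu_N] has length N + 1.  Derive and Derive_n are
   total, so the differentiability required of a solution of the ODE is stated
   separately.  Exponents are real, hence so is the solution. *)
Definition is_fundamental (mu : list R) (f : R -> R) : Prop :=
  (forall k x, (k <= length mu)%nat -> ex_derive_n f k x) /\
  (forall x, diff_op mu f x = 0) /\
  (forall k, (k < length mu - 1)%nat -> Derive_n f k 0 = 0) /\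
  Derive_n f (length mu - 1) 0 = 1.

(* The initial value problem has exactly one solution for every nonempty mu,
   so the description operator picks it out. *)
Definition Phi (mu : list R) : R -> R :=
  epsilon (inhabits (fun _ : R => 0)) (is_fundamental mu).

Definition rho (l0 l1 l2 l3 : R) (x : R) : R :=
  (Derive (Phi [l0; l1; l2; l3]) x * Phi [l0; l1] x
   - Phi [l0; l1; l2; l3] x * Derive (Phi [l0; l1]) x)
  / (Phi [l0; l1] x * Phi [l2; l3] x).

Definition sigma (l0 l1 l2 l3 : R) (x : R) : R :=
  Phi [l0; l1; l2; l3] x / (Phi [l0; l1] x * Phi [l2; l3] x).

(* Entry (i, j) of R with the 1-based indexing of the knots t_1 < ... < t_n;
   only rows 2 <= i <= n - 1 are meaningful.  Columns 1 and n of rows 2 and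
   n - 1 lie outside the square matrix but are given by the same formulas. *)
Definition Rmat (l0 l1 l2 l3 : R) (t : nat -> R) (i j : nat) : R :=
  if (j =? i)%nat then
    rho l0 l1 l2 l3 (t i - t (i - 1)%nat)
    - rho l0 l1 l2 l3 (- (t (i + 1)%nat - t i))
  else if (j =? i + 1)%nat then
    sigma l0 l1 l2 l3 (t (i + 1)%nat - t i)
  else if (j =? i - 1)%nat then
    - sigma l0 l1 l2 l3 (- (t i - t (i - 1)%nat))
  else 0.

(* Main.v *)
Require Import Defs.
From Stdlib Require Import Reals List Arith ClassicalEpsilon.
From Stdlib Require Import Lra Lia.
From Coquelicot Require Import Coquelicot.
Import ListNotations.
Open Scope R_scope.

(** Write A, B and P for the fundamental functions of (a, -a), (-b, b) and
    (a, -a, -b, b).  All three are odd, so sigma and rho are odd, and with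
    h = t_j - t_(j-1) and k = t_(j+1) - t_j the claim becomes
    sigma h + sigma k <= (rho h + rho k) / 2.  It is therefore enough to show
    2 sigma <= rho on the positive half-line, that is, after clearing the
    positive denominator A B,

      F := (P' A - P A') - 2 P >= 0   for x >= 0.

    The closed form of P degenerates when a = b, so the proof uses only the
    differential equations
      A'' = a^2 A,   B'' = b^2 B,   P'' = b^2 P + A,
    together with their consequence (a^2 - b^2) P = A - B
    ([response_difference]), equivalently P'' = a^2 P + B.  These give
    F' = A B - 2 P'.  Put y = F'.  Differentiating twice more,

      y'' = (a^2 + b^2) y + (a^2 + b^2) P' + A' (B' - 1) + B' (A' - 1).

    Here A', B' >= 1 and P' >= 0, so y'' >= (a^2 + b^2) y with
    y(0) = y'(0) = 0; the comparison principle [nonneg_of_second_order] gives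
    y >= 0, and hence F >= 0 ([response_wronskian_bound]).

    The equations themselves come from the recursion
    (d/dx - m) Phi(mu, m) = Phi(mu) ([Phi_snoc_derive]).  As Phi is obtained by
    a description operator, this needs existence and uniqueness of fundamental
    functions, both by induction on the list of exponents, peeling off the
    factor that acts first. *)

(** * First-order linear equations *)

Lemma diff_op_ext (mu : list R) (f g : R -> R) :
  (forall x, f x = g x) -> forall x, diff_op mu f x = diff_op mu g x.
Proof.
  intros Hfg; induction mu as [|m mu IH]; intros x; simpl; [apply Hfg|].
  now rewrite IH, (Derive_ext _ _ x IH).
Qed.

(** The last exponent of the list is the factor applied first to the function,
    so a solution for (mu, m) is a solution of f' - m f = g with g a solution
    for mu. *)
Lemma diff_op_snoc (mu : list R) (m : R) (f : R -> R) (x : R) :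
  diff_op (mu ++ [m]) f x = diff_op mu (fun y => Derive f y - m * f y) x.
Proof. unfold diff_op; now rewrite fold_right_app. Qed.

(** The integrating factor: exp (m x) turns y' + m y into an exact derivative. *)
Lemma is_derive_exp_mul (m : R) (y : R -> R) (x d : R) :
  is_derive y x d ->
  is_derive (fun u => exp (m * u) * y u) x (exp (m * x) * (m * y x + d)).
Proof.
  intros Hy.
  assert (He : is_derive (fun u => exp (m * u)) x (m * exp (m * x))).
  { auto_derive; [easy|ring]. }
  generalize (is_derive_mult _ _ x _ _ He Hy Rmult_comm).
  unfold plus, mult; simpl; intros H.
  replace (exp (m * x) * (m * y x + d))
    with (m * exp (m * x) * y x + exp (m * x) * d) by ring.
  exact H.
Qed.

Lemma zero_of_first_order (m : R) (y : R -> R) :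
  (forall x, is_derive y x (m * y x)) -> y 0 = 0 -> forall x, y x = 0.
Proof.
  intros Hy Hy0 x.
  set (z := fun u => exp (- m * u) * y u).
  assert (Hz : forall u, is_derive z u 0).
  { intros u. replace 0 with (exp (- m * u) * (- m * y u + m * y u)) by ring.
    apply is_derive_exp_mul, Hy. }
  assert (Hzx : z x = 0).
  { assert (Hz0 : z 0 = 0) by (unfold z; rewrite Hy0; ring).
    destruct (Rtotal_order x 0) as [Hx|[->|Hx]]; [|easy|]; rewrite <- Hz0.
    - apply (eq_is_derive z x 0); [intros; apply Hz|exact Hx].
    - symmetry; apply (eq_is_derive z 0 x); [intros; apply Hz|exact Hx]. }
  unfold z in Hzx; apply Rmult_integral in Hzx as [H|H]; [|exact H].
  generalize (exp_pos (- m * x)); lra.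
Qed.

Lemma Derive_n_of_ode (m : R) (f g : R -> R) :
  (forall n x, ex_derive_n g n x) ->
  (forall x, is_derive f x (m * f x + g x)) ->
  forall n x, is_derive (Derive_n f n) x (m * Derive_n f n x + Derive_n g n x).
Proof.
  intros Hg Hf n; induction n as [|n IH]; intros x; [apply Hf|].
  assert (HS : forall u, Derive_n f (S n) u = m * Derive_n f n u + Derive_n g n u).
  { intros u; apply is_derive_unique, IH. }
  apply (is_derive_ext (fun u => m * Derive_n f n u + Derive_n g n u)).
  { intros u; symmetry; apply HS. }
  rewrite HS.
  apply (is_derive_plus (V := R_NormedModule)).
  - apply (is_derive_scal (Derive_n f n)), IH.
  - apply Derive_correct, (Hg (S n)).
Qed.

(** Variation of constants: f x = int_0^x exp (m (x - u)) g u du. *)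
Lemma duhamel (m : R) (g : R -> R) :
  (forall x, continuous g x) ->
  exists f : R -> R, f 0 = 0 /\ forall x, is_derive f x (m * f x + g x).
Proof.
  intros Hg.
  set (k := fun u => exp (- m * u) * g u).
  assert (Hk : forall x, continuous k x).
  { intros x; apply (continuous_mult (fun u => exp (- m * u)) g); [|apply Hg].
    apply (ex_derive_continuous (fun u => exp (- m * u))); auto_derive; easy. }
  exists (fun x => exp (m * x) * RInt k 0 x); split.
  { rewrite RInt_point; unfold zero; simpl; ring. }
  intros x.
  assert (HI : is_derive (RInt k 0) x (k x)).
  { apply (is_derive_RInt k (RInt k 0) 0 x); [|apply Hk].
    exists (mkposreal _ Rlt_0_1); intros u _.
    apply (RInt_correct k), (ex_RInt_continuous k); intros; apply Hk. }
  replace (m * (exp (m * x) * RInt k 0 x) + g x)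
    with (exp (m * x) * (m * RInt k 0 x + k x)).
  - now apply is_derive_exp_mul.
  - unfold k. replace (- m * x) with (- (m * x)) by ring.
    rewrite exp_Ropp; field; apply Rgt_not_eq, exp_pos.
Qed.

(** * Existence and uniqueness of fundamental functions *)

(** From a fundamental g for mu, [duhamel] gives f' = m f + g with f 0 = 0.
    Then f^(k+1) = m f^(k) + g^(k), so each initial condition of g passes to the
    next higher derivative of f.  The induction carries smoothness of all
    orders, since that is what makes this identity available for every k. *)
Lemma fundamental_exists (mu : list R) :
  mu <> [] -> exists f, is_fundamental mu f.
Proof.
  intros Hmu.
  cut (exists f, is_fundamental mu f /\ forall n x, ex_derive_n f n x).
  { intros [f [Hf _]]; now exists f. }
  induction mu as [|m mu IH] using rev_ind; [easy|clear Hmu].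
  assert (Hsmooth : forall f g, (forall n x, ex_derive_n g n x) ->
    (forall x, is_derive f x (m * f x + g x)) -> forall n x, ex_derive_n f n x).
  { intros f g Hg Hf [|n] x; [easy|].
    eexists; apply (Derive_n_of_ode m f g Hg Hf n x). }
  destruct mu as [|m0 mu'].
  - set (f := fun x => exp (m * x)).
    assert (Hf : forall x, is_derive f x (m * f x)).
    { intros x; unfold f; auto_derive; [easy|ring]. }
    exists f.
    assert (Hs : forall n x, ex_derive_n f n x).
    { apply (Hsmooth f (fun _ => 0)).
      - intros n x; apply ex_derive_n_const.
      - intros x; rewrite Rplus_0_r; apply Hf. }
    split; [|exact Hs]; repeat split.
    + intros k x _; apply Hs.
    + intros x; simpl. rewrite (is_derive_unique _ _ _ (Hf x)); ring.
    + intros k Hk; simpl in Hk; lia.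
    + simpl; unfold f; rewrite Rmult_0_r; apply exp_0.
  - destruct IH as [g [[_ [Hg [Hg0 Hg1]]] Hgs]]; [easy|].
    set (mu := m0 :: mu') in *.
    assert (Hlen : (1 <= length mu)%nat) by (simpl; lia).
    destruct (duhamel m g) as [f [Hf0 Hf]].
    { intros x; apply (ex_derive_continuous g), (Hgs 1%nat). }
    pose proof (Hsmooth f g Hgs Hf) as Hs.
    pose proof (Derive_n_of_ode m f g Hgs Hf) as Hn.
    assert (HS : forall n x,
      Derive_n f (S n) x = m * Derive_n f n x + Derive_n g n x).
    { intros n x; apply is_derive_unique, Hn. }
    assert (Hz : forall k, (k < length mu)%nat -> Derive_n f k 0 = 0).
    { induction k as [|k IHk]; intros Hk; [exact Hf0|].
      rewrite HS, IHk, Hg0 by lia; ring. }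
    exists f; split; [|exact Hs]; repeat split.
    + intros k x _; apply Hs.
    + intros x; rewrite diff_op_snoc, <- (Hg x).
      apply diff_op_ext; intros u.
      rewrite (is_derive_unique _ _ _ (Hf u)); ring.
    + intros k; rewrite length_app; simpl length; intros Hk; apply Hz.
      simpl; lia.
    + rewrite length_app; simpl (length [m]).
      replace (length mu + 1 - 1)%nat with (S (length mu - 1)) by lia.
      rewrite HS, Hz, Hg1 by lia; ring.
Qed.

(** The converse of the construction in [fundamental_exists]; it reduces
    uniqueness for (mu, m) to uniqueness for mu and a first-order equation. *)
Lemma fundamental_snoc_inv (mu : list R) (m : R) (f : R -> R) :
  mu <> [] -> is_fundamental (mu ++ [m]) f ->
  is_fundamental mu (fun x => Derive f x - m * f x).
Proof.
  intros Hmu [Hs [Hd [H0 H1]]].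
  assert (Hlen : (1 <= length mu)%nat) by (destruct mu; simpl; [easy|lia]).
  rewrite length_app in Hs, H0, H1; simpl (length [m]) in *.
  set (g := fun x => Derive f x - m * f x).
  assert (Hfd : forall k x, (k <= length mu)%nat -> ex_derive (Derive_n f k) x).
  { intros k x Hk; apply (Hs (S k) x); lia. }
  assert (Hgn : forall k x, (k <= length mu)%nat ->
    Derive_n g k x = Derive_n f (S k) x - m * Derive_n f k x).
  { induction k as [|k IH]; intros x Hk; [easy|].
    simpl Derive_n at 1.
    rewrite (Derive_ext _ (fun u => Derive_n f (S k) u - m * Derive_n f k u))
      by (intros u; apply IH; lia).
    rewrite (Derive_minus (Derive_n f (S k)) (fun u => m * Derive_n f k u)).
    - now rewrite Derive_scal.
    - apply Hfd; lia.
    - apply ex_derive_scal, Hfd; lia. }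
  repeat split.
  - intros [|k] x Hk; [easy|].
    apply (ex_derive_ext (fun u => Derive_n f (S k) u - m * Derive_n f k u)).
    { intros u; symmetry; apply Hgn; lia. }
    apply (ex_derive_minus (V := R_NormedModule) (Derive_n f (S k))
             (fun u => m * Derive_n f k u)).
    + apply Hfd; lia.
    + apply ex_derive_scal, Hfd; lia.
  - intros x; rewrite <- (Hd x), diff_op_snoc; reflexivity.
  - intros k Hk; rewrite Hgn, !H0 by lia; ring.
  - rewrite Hgn by lia.
    replace (S (length mu - 1)) with (length mu + 1 - 1)%nat by lia.
    rewrite H1, H0 by lia; ring.
Qed.

Lemma fundamental_at_0 (mu : list R) (m : R) (f : R -> R) :
  mu <> [] -> is_fundamental (mu ++ [m]) f -> f 0 = 0.
Proof.
  intros Hmu [_ [_ [H _]]]; apply (H 0%nat).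
  rewrite length_app; destruct mu; simpl; [easy|lia].
Qed.

Lemma fundamental_is_derive (mu : list R) (m : R) (f : R -> R) (x : R) :
  is_fundamental (mu ++ [m]) f ->
  is_derive f x (m * f x + (Derive f x - m * f x)).
Proof.
  intros [Hs _].
  replace (m * f x + (Derive f x - m * f x)) with (Derive f x) by ring.
  apply Derive_correct, (Hs 1%nat); rewrite length_app; simpl; lia.
Qed.

Lemma fundamental_unique (mu : list R) (f1 f2 : R -> R) :
  mu <> [] -> is_fundamental mu f1 -> is_fundamental mu f2 ->
  forall x, f1 x = f2 x.
Proof.
  revert f1 f2; induction mu as [|m mu IH] using rev_ind; [easy|].
  intros f1 f2 _ H1 H2 x.
  assert (H : (forall u, Derive f1 u - m * f1 u = Derive f2 u - m * f2 u)
              /\ f1 0 = f2 0).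
  { destruct mu as [|m0 mu'].
    - destruct H1 as [_ [D1 [_ I1]]], H2 as [_ [D2 [_ I2]]].
      simpl in *; split; [intros u; now rewrite D1, D2|now rewrite I1, I2].
    - split.
      + apply (IH (fun u => Derive f1 u - m * f1 u)
                  (fun u => Derive f2 u - m * f2 u)); [easy| |];
          apply fundamental_snoc_inv; easy.
      + transitivity 0; [|symmetry];
          now apply (fundamental_at_0 (m0 :: mu') m). }
  destruct H as [HD H0].
  apply Rminus_diag_uniq.
  apply (zero_of_first_order m (fun u => f1 u - f2 u)); [|simpl; lra].
  intros u.
  replace (m * (f1 u - f2 u))
    with (minus (m * f1 u + (Derive f1 u - m * f1 u))
                (m * f2 u + (Derive f2 u - m * f2 u)))
    by (unfold minus, plus, opp; simpl; rewrite HD; ring).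
  apply (is_derive_minus f1 f2); now apply fundamental_is_derive with mu.
Qed.

Lemma Phi_fundamental (mu : list R) : mu <> [] -> is_fundamental mu (Phi mu).
Proof. intros Hmu; unfold Phi; apply epsilon_spec, fundamental_exists, Hmu. Qed.

(** This recursion is the only property of Phi for longer lists that the rest of
    the argument needs, besides the values at 0. *)
Lemma Phi_snoc_derive (mu : list R) (m x : R) :
  mu <> [] ->
  is_derive (Phi (mu ++ [m])) x (m * Phi (mu ++ [m]) x + Phi mu x).
Proof.
  intros Hmu.
  assert (Hf : is_fundamental (mu ++ [m]) (Phi (mu ++ [m]))).
  { apply Phi_fundamental; now destruct mu. }
  rewrite (fundamental_unique mu (Phi mu)
             (fun u => Derive (Phi (mu ++ [m])) u - m * Phi (mu ++ [m]) u) Hmu).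
  - now apply fundamental_is_derive with mu.
  - now apply Phi_fundamental.
  - now apply fundamental_snoc_inv.
Qed.

Lemma Phi_snoc_0 (mu : list R) (m : R) : mu <> [] -> Phi (mu ++ [m]) 0 = 0.
Proof.
  intros Hmu; apply (fundamental_at_0 mu m); [easy|].
  apply Phi_fundamental; now destruct mu.
Qed.

Lemma Phi_single_derive (m x : R) : is_derive (Phi [m]) x (m * Phi [m] x).
Proof.
  assert (Hf : is_fundamental [m] (Phi [m])) by now apply Phi_fundamental.
  pose proof (fundamental_is_derive [] m _ x Hf) as H.
  destruct Hf as [_ [Hd _]].
  specialize (Hd x); simpl in Hd; now rewrite Hd, Rplus_0_r in H.
Qed.

Lemma Phi_single_0 (m : R) : Phi [m] 0 = 1.
Proof. now destruct (Phi_fundamental [m] ltac:(easy)) as [_ [_ [_ H]]]. Qed.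

(** * Second-order equations: uniqueness and comparison *)

(** Factor d^2/dx^2 - m^2 as (d/dx + m) (d/dx - m). *)
Lemma zero_of_second_order (m : R) (y dy : R -> R) :
  (forall x, is_derive y x (dy x)) ->
  (forall x, is_derive dy x (m ^ 2 * y x)) ->
  y 0 = 0 -> dy 0 = 0 -> forall x, y x = 0.
Proof.
  intros Hy Hdy H0 H1.
  assert (Hz : forall x, dy x - m * y x = 0).
  { apply (zero_of_first_order (- m)); [|rewrite H0, H1; ring].
    intros x; replace (- m * (dy x - m * y x))
      with (minus (m ^ 2 * y x) (m * dy x))
      by (unfold minus, plus, opp; simpl; ring).
    apply (is_derive_minus dy (fun u => m * y u)); [apply Hdy|].
    apply (is_derive_scal y), Hy. }
  apply (zero_of_first_order m); [|exact H0].
  intros x; replace (m * y x) with (dy x) by (specialize (Hz x); lra).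
  apply Hy.
Qed.

(** exp (- m x) y is nondecreasing. *)
Lemma nonneg_of_first_order (m : R) (y dy : R -> R) :
  (forall x, is_derive y x (dy x)) ->
  (forall x, 0 <= x -> m * y x <= dy x) ->
  0 <= y 0 -> forall x, 0 <= x -> 0 <= y x.
Proof.
  intros Hy Hle H0 x Hx.
  set (z := fun u => exp (- m * u) * y u).
  set (dz := fun u => exp (- m * u) * (- m * y u + dy u)).
  assert (Hz : forall u, is_derive z u (dz u)).
  { intros u; apply is_derive_exp_mul, Hy. }
  assert (Hzx : z 0 <= z x).
  { destruct (MVT_gen z 0 x dz) as [u [Hu E]].
    - intros; apply Hz.
    - intros u _; apply continuity_pt_filterlim.
      apply (ex_derive_continuous z); exists (dz u); apply Hz.
    - rewrite Rmin_left in Hu by exact Hx.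
      assert (Hd : 0 <= dz u).
      { apply Rmult_le_pos; [apply Rlt_le, exp_pos|].
        specialize (Hle u (proj1 Hu)); lra. }
      generalize (Rmult_le_pos (dz u) (x - 0) Hd ltac:(lra)); lra. }
  unfold z in Hzx; rewrite Rmult_0_r, exp_0, Rmult_1_l in Hzx.
  apply (Rmult_le_reg_l (exp (- m * x))); [apply exp_pos|lra].
Qed.

(** The same factorization as for uniqueness: z = y' - m y satisfies
    z' >= - m z, so z >= 0, and then y' >= m y gives y >= 0. *)
Lemma nonneg_of_second_order (m : R) (y dy ddy : R -> R) :
  (forall x, is_derive y x (dy x)) ->
  (forall x, is_derive dy x (ddy x)) ->
  (forall x, 0 <= x -> m ^ 2 * y x <= ddy x) ->
  0 <= y 0 -> m * y 0 <= dy 0 ->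
  forall x, 0 <= x -> 0 <= y x /\ m * y x <= dy x.
Proof.
  intros Hy Hdy Hle H0 H1.
  assert (Hz : forall x, 0 <= x -> 0 <= dy x - m * y x).
  { apply (nonneg_of_first_order (- m) _ (fun x => ddy x - m * dy x)); [| |lra].
    - intros x; apply (is_derive_minus dy (fun u => m * y u)); [apply Hdy|].
      apply (is_derive_scal y), Hy.
    - intros x Hx; specialize (Hle x Hx); lra. }
  intros x Hx; split; [|specialize (Hz x Hx); lra].
  apply (nonneg_of_first_order m y dy); auto.
  intros u Hu; specialize (Hz u Hu); lra.
Qed.

(** * The functions sinh (c x) / c *)

(** S is sinh (c x) / c, or the identity when c = 0.  Characterizing it by its
    initial value problem treats both cases at once. *)
Definition is_sinh (c : R) (S dS : R -> R) : Prop :=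
  (forall x, is_derive S x (dS x)) /\
  (forall x, is_derive dS x (c ^ 2 * S x)) /\ S 0 = 0 /\ dS 0 = 1.

(** y = S' - 1 satisfies y'' = c^2 S' = c^2 y + c^2 >= c^2 y and
    y(0) = y'(0) = 0. *)
Lemma sinh_slope_ge1 (c : R) (S dS : R -> R) (x : R) :
  is_sinh c S dS -> 0 <= x -> 1 <= dS x.
Proof.
  intros [HS [HdS [H0 H1]]] Hx.
  destruct (nonneg_of_second_order c (fun u => dS u - 1)
    (fun u => c ^ 2 * S u) (fun u => c ^ 2 * dS u)) with x as [H _];
    try easy; [| | | | |lra].
  - intros u; replace (c ^ 2 * S u) with (minus (c ^ 2 * S u) zero)
      by (unfold minus, plus, opp, zero; simpl; ring).
    apply (is_derive_minus dS (fun _ => 1)); [apply HdS|apply @is_derive_const].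
  - intros u; apply (is_derive_scal S), HS.
  - intros u _; generalize (pow2_ge_0 c); lra.
  - rewrite H1; lra.
  - rewrite H0, H1; lra.
Qed.

Lemma sinh_pos (c : R) (S dS : R -> R) (x : R) :
  is_sinh c S dS -> 0 < x -> 0 < S x.
Proof.
  intros HS Hx.
  assert (H : 0 <= S x - x); [|lra].
  apply (nonneg_of_first_order 0 (fun u => S u - u) (fun u => dS u - 1)); [| | |lra].
  - intros u; apply (is_derive_minus S (fun v => v)); [apply HS|apply @is_derive_id].
  - intros u Hu; generalize (sinh_slope_ge1 c S dS u HS Hu); lra.
  - destruct HS as [_ [_ [H0 _]]]; rewrite H0; lra.
Qed.

Lemma is_derive_reflect (y : R -> R) (d x : R) :
  is_derive y (- x) d -> is_derive (fun u => y (- u)) x (- d).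
Proof.
  intros H; replace (- d) with (scal (- 1) d)
    by (unfold scal; simpl; unfold mult; simpl; ring).
  apply (is_derive_comp y Ropp); [exact H|].
  auto_derive; [easy|ring].
Qed.

(** y x + y (- x) solves the homogeneous equation with zero data at 0, because
    the forcing terms cancel. *)
Lemma odd_of_second_order (m : R) (y dy f : R -> R) :
  (forall x, is_derive y x (dy x)) ->
  (forall x, is_derive dy x (m ^ 2 * y x + f x)) ->
  (forall x, f (- x) = - f x) ->
  y 0 = 0 -> forall x, y (- x) = - y x /\ dy (- x) = dy x.
Proof.
  intros Hy Hdy Hf H0.
  assert (Hodd : forall x, y (- x) = - y x).
  { intros x; cut (y x + y (- x) = 0); [lra|].
    apply (zero_of_second_order m (fun u => y u + y (- u))
             (fun u => dy u + - dy (- u))).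
    - intros u; apply (is_derive_plus y (fun v => y (- v))); [apply Hy|].
      apply is_derive_reflect, Hy.
    - intros u; replace (m ^ 2 * (y u + y (- u)))
        with (plus (m ^ 2 * y u + f u) (opp (- (m ^ 2 * y (- u) + f (- u)))))
        by (unfold plus, opp; simpl; rewrite Hf; ring).
      apply (is_derive_plus dy (fun v => - dy (- v))); [apply Hdy|].
      apply (is_derive_opp (fun v => dy (- v))), is_derive_reflect, Hdy.
    - rewrite Ropp_0, H0; ring.
    - rewrite Ropp_0; ring. }
  intros x; split; [apply Hodd|].
  assert (H : is_derive y x (- - dy (- x))).
  { apply (is_derive_ext (fun u => - y (- u))).
    - intros u; rewrite Hodd; apply Ropp_involutive.
    - apply (is_derive_opp (fun u => y (- u))), is_derive_reflect, Hy. }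
  rewrite Ropp_involutive in H; apply is_derive_unique in H.
  rewrite <- H; apply is_derive_unique, Hy.
Qed.

Lemma sinh_odd (c : R) (S dS : R -> R) (x : R) :
  is_sinh c S dS -> S (- x) = - S x /\ dS (- x) = dS x.
Proof.
  intros [HS [HdS [H0 _]]].
  apply (odd_of_second_order c S dS (fun _ => 0)); try easy.
  - intros u; rewrite Rplus_0_r; apply HdS.
  - intros _; ring.
Qed.

(** * The Wronskian inequality *)

(** P is the response of the equation y'' = b^2 y, started at rest, to the forcing A.  The
    defect (a^2 - b^2) P - (A - B) solves y'' = b^2 y with zero data at 0.  This
    is the explicit formula for P multiplied by a^2 - b^2, hence meaningful also
    when a^2 = b^2; it restores the symmetry between a and b. *)
Lemma response_difference (a b : R) (A dA B dB P dP : R -> R) :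
  is_sinh a A dA -> is_sinh b B dB ->
  (forall x, is_derive P x (dP x)) ->
  (forall x, is_derive dP x (b ^ 2 * P x + A x)) ->
  P 0 = 0 -> dP 0 = 0 ->
  forall x, (a ^ 2 - b ^ 2) * P x = A x - B x
            /\ (a ^ 2 - b ^ 2) * dP x = dA x - dB x.
Proof.
  intros [HA [HdA [A0 A1]]] [HB [HdB [B0 B1]]] HP HdP P0 P1.
  set (c := a ^ 2 - b ^ 2).
  set (y := fun u => c * P u - (A u - B u)).
  set (dy := fun u => c * dP u - (dA u - dB u)).
  assert (Hy : forall u, is_derive y u (dy u)).
  { intros u; apply (is_derive_minus (fun v => c * P v) (fun v => A v - B v)).
    - apply (is_derive_scal P), HP.
    - apply (is_derive_minus A B); [apply HA|apply HB]. }
  assert (Hdy : forall u, is_derive dy u (b ^ 2 * y u)).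
  { intros u.
    replace (b ^ 2 * y u)
      with (minus (c * (b ^ 2 * P u + A u)) (minus (a ^ 2 * A u) (b ^ 2 * B u)))
      by (unfold minus, plus, opp, y, c; simpl; ring).
    apply (is_derive_minus (fun v => c * dP v) (fun v => dA v - dB v)).
    - apply (is_derive_scal dP), HdP.
    - apply (is_derive_minus dA dB); [apply HdA|apply HdB]. }
  assert (Hz : forall u, y u = 0).
  { apply (zero_of_second_order b y dy Hy Hdy); unfold y, dy.
    - rewrite P0, A0, B0; ring.
    - rewrite P1, A1, B1; ring. }
  intros x; split; [generalize (Hz x); unfold y; lra|].
  assert (H : dy x = 0).
  { rewrite <- (is_derive_unique _ _ _ (Hy x)).
    rewrite (Derive_ext y (fun _ => 0) x Hz); apply Derive_const. }
  unfold dy in H; lra.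
Qed.

(** With F the difference of the two sides, y = F' = A B - 2 P' satisfies
    y'' >= (a^2 + b^2) y with zero data at 0. *)
Lemma response_wronskian_bound (a b : R) (A dA B dB P dP : R -> R) :
  0 <= b -> is_sinh a A dA -> is_sinh b B dB ->
  (forall x, is_derive P x (dP x)) ->
  (forall x, is_derive dP x (b ^ 2 * P x + A x)) ->
  P 0 = 0 -> dP 0 = 0 ->
  forall x, 0 <= x -> 2 * P x <= dP x * A x - P x * dA x.
Proof.
  intros Hb SA SB HP HdP P0 P1.
  pose proof (response_difference a b A dA B dB P dP SA SB HP HdP P0 P1) as Hdiff.
  pose proof (fun u => sinh_slope_ge1 a A dA u SA) as HA1.
  pose proof (fun u => sinh_slope_ge1 b B dB u SB) as HB1.
  assert (HApos : forall u, 0 <= u -> 0 <= A u).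
  { intros u [Hu|<-]; [now apply Rlt_le, (sinh_pos a A dA)|].
    destruct SA as [_ [_ [H _]]]; rewrite H; lra. }
  destruct SA as [HA [HdA [A0 A1]]], SB as [HB [HdB [B0 B1]]].
  assert (HdP0 : forall u, 0 <= u -> 0 <= dP u).
  { intros u Hu.
    destruct (nonneg_of_second_order b P dP (fun v => b ^ 2 * P v + A v))
      with u as [H1 H2]; try easy.
    - intros v Hv; generalize (HApos v Hv); lra.
    - rewrite P0; lra.
    - rewrite P0, P1; lra.
    - generalize (Rmult_le_pos b (P u) Hb H1); lra. }
  set (y := fun u => A u * B u - 2 * dP u).
  set (dy := fun u => dA u * B u + A u * dB u - 2 * (b ^ 2 * P u + A u)).
  set (ddy := fun u => (a ^ 2 * A u * B u + dA u * dB u)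
    + (dA u * dB u + A u * (b ^ 2 * B u)) - 2 * (b ^ 2 * dP u + dA u)).
  assert (Hy : forall u, is_derive y u (dy u)).
  { intros u; apply (is_derive_minus (fun v => A v * B v) (fun v => 2 * dP v)).
    - apply (is_derive_mult A B u (dA u) (dB u) (HA u) (HB u) Rmult_comm).
    - apply (is_derive_scal dP), HdP. }
  assert (Hdy : forall u, is_derive dy u (ddy u)).
  { intros u; apply (is_derive_minus (fun v => dA v * B v + A v * dB v)
                       (fun v => 2 * (b ^ 2 * P v + A v))).
    - apply (is_derive_plus (fun v => dA v * B v) (fun v => A v * dB v)).
      + apply (is_derive_mult dA B u _ _ (HdA u) (HB u) Rmult_comm).
      + apply (is_derive_mult A dB u _ _ (HA u) (HdB u) Rmult_comm).
    - apply (is_derive_scal (fun v => b ^ 2 * P v + A v)).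
      apply (is_derive_plus (fun v => b ^ 2 * P v) A); [|apply HA].
      apply (is_derive_scal P), HP. }
  (* The comparison principle takes the coefficient as a square m ^ 2. *)
  assert (Hm : sqrt (a ^ 2 + b ^ 2) ^ 2 = a ^ 2 + b ^ 2).
  { apply pow2_sqrt; generalize (pow2_ge_0 a), (pow2_ge_0 b); lra. }
  assert (Hy0 : forall u, 0 <= u -> 0 <= y u).
  { intros u Hu.
    destruct (nonneg_of_second_order (sqrt (a ^ 2 + b ^ 2)) y dy ddy)
      with u as [H _]; try easy; unfold y, dy.
    (* By Hdiff, ddy - (a^2 + b^2) y is the sum of the terms in H1, H2 and H3. *)
    - intros v Hv; rewrite Hm; unfold ddy.
      destruct (Hdiff v) as [_ Hd].
      specialize (HA1 v Hv); specialize (HB1 v Hv); specialize (HdP0 v Hv).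
      assert (H1 : 0 <= (a ^ 2 + b ^ 2) * dP v).
      { apply Rmult_le_pos; [|exact HdP0].
        generalize (pow2_ge_0 a), (pow2_ge_0 b); lra. }
      assert (H2 : 0 <= dA v * (dB v - 1)) by (apply Rmult_le_pos; lra).
      assert (H3 : 0 <= dB v * (dA v - 1)) by (apply Rmult_le_pos; lra).
      lra.
    - rewrite A0, P1; lra.
    - rewrite A0, B0, P0, P1; lra. }
  intros x Hx.
  cut (0 <= dP x * A x - P x * dA x - 2 * P x); [lra|].
  apply (nonneg_of_first_order 0
    (fun u => dP u * A u - P u * dA u - 2 * P u) y); [| | |exact Hx].
  - intros u.
    replace (y u) with (minus (minus
        (plus (mult (b ^ 2 * P u + A u) (A u)) (mult (dP u) (dA u)))
        (plus (mult (dP u) (dA u)) (mult (P u) (a ^ 2 * A u)))) (2 * dP u)).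
    + apply (is_derive_minus (fun v => dP v * A v - P v * dA v) (fun v => 2 * P v)).
      * apply (is_derive_minus (fun v => dP v * A v) (fun v => P v * dA v)).
        -- apply (is_derive_mult dP A u _ _ (HdP u) (HA u) Rmult_comm).
        -- apply (is_derive_mult P dA u _ _ (HP u) (HdA u) Rmult_comm).
      * apply (is_derive_scal P), HP.
    (* Here P'' = a^2 P + B is used, obtained from the difference formula. *)
    + unfold minus, plus, opp, mult, y; simpl.
      destruct (Hdiff u) as [Hd _].
      replace (B u) with (A u - (a ^ 2 - b ^ 2) * P u) by lra; ring.
  - intros u Hu; rewrite Rmult_0_l; now apply Hy0.
  - rewrite A0, P0; lra.
Qed.

(** * The fundamental functions of the theorem *)

Lemma Phi_opposite_pair (p q : R) :
  p + q = 0 -> is_sinh q (Phi [p; q]) (Derive (Phi [p; q])).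
Proof.
  intros Hpq.
  assert (H1 : forall x, is_derive (Phi [p; q]) x (q * Phi [p; q] x + Phi [p] x)).
  { intros x; now apply (Phi_snoc_derive [p]). }
  assert (HD : forall x, q * Phi [p; q] x + Phi [p] x = Derive (Phi [p; q]) x).
  { intros x; symmetry; apply is_derive_unique, H1. }
  assert (H0 : Phi [p; q] 0 = 0) by now apply (Phi_snoc_0 [p]).
  split; [|split; [|split]]; [intros x; rewrite <- HD; apply H1| |exact H0|].
  - intros x; apply (is_derive_ext _ _ x _ HD).
    replace (q ^ 2 * Phi [p; q] x)
      with (plus (q * (q * Phi [p; q] x + Phi [p] x)) (p * Phi [p] x))
      by (unfold plus; simpl; replace p with (- q) by lra; ring).
    apply (is_derive_plus (fun u => q * Phi [p; q] u) (Phi [p])).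
    + apply (is_derive_scal (Phi [p; q])), H1.
    + apply Phi_single_derive.
  - rewrite <- HD, H0, Phi_single_0; ring.
Qed.

(** Adding the pair (p, q) with p = - q inverts the operator
    (d/dx - p) (d/dx - q) = d^2/dx^2 - q^2 with zero initial data. *)
Lemma Phi_snoc_opposite_pair (mu : list R) (p q : R) :
  mu <> [] -> p + q = 0 ->
  let P := Phi (mu ++ [p; q]) in
  (forall x, is_derive P x (Derive P x)) /\
  (forall x, is_derive (Derive P) x (q ^ 2 * P x + Phi mu x)) /\
  P 0 = 0 /\ Derive P 0 = 0.
Proof.
  intros Hmu Hpq P.
  set (Q := Phi (mu ++ [p])).
  assert (Hmu' : mu ++ [p] <> []) by now destruct mu.
  assert (HQ : forall x, is_derive Q x (p * Q x + Phi mu x)).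
  { intros x; now apply Phi_snoc_derive. }
  assert (EP : P = Phi ((mu ++ [p]) ++ [q])) by now rewrite <- app_assoc.
  assert (HP : forall x, is_derive P x (q * P x + Q x)).
  { intros x; rewrite EP; now apply Phi_snoc_derive. }
  assert (HD : forall x, q * P x + Q x = Derive P x).
  { intros x; symmetry; apply is_derive_unique, HP. }
  assert (P0 : P 0 = 0) by (rewrite EP; now apply Phi_snoc_0).
  assert (Q0 : Q 0 = 0) by now apply Phi_snoc_0.
  split; [|split; [|split]]; [intros x; rewrite <- HD; apply HP| |exact P0|].
  - intros x; apply (is_derive_ext _ _ x _ HD).
    replace (q ^ 2 * P x + Phi mu x)
      with (plus (q * (q * P x + Q x)) (p * Q x + Phi mu x))
      by (unfold plus; simpl; replace p with (- q) by lra; ring).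
    apply (is_derive_plus (fun u => q * P u) Q); [|apply HQ].
    apply (is_derive_scal P), HP.
  - rewrite <- HD, P0, Q0; ring.
Qed.

Lemma two_sigma_le_rho_and_odd (a b h : R) : 0 <= b -> 0 < h ->
  2 * Defs.sigma a (- a) (- b) b h <= rho a (- a) (- b) b h /\
  Defs.sigma a (- a) (- b) b (- h) = - Defs.sigma a (- a) (- b) b h /\
  rho a (- a) (- b) b (- h) = - rho a (- a) (- b) b h.
Proof.
  intros Hb Hh.
  assert (SA : is_sinh (- a) (Phi [a; - a]) (Derive (Phi [a; - a])))
    by (apply Phi_opposite_pair; ring).
  assert (SB : is_sinh b (Phi [- b; b]) (Derive (Phi [- b; b])))
    by (apply Phi_opposite_pair; ring).
  destruct (Phi_snoc_opposite_pair [a; - a] (- b) b) as [HP [HdP [P0 P1]]];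
    [easy|ring|].
  simpl app in *; unfold Defs.sigma, rho.
  pose proof (response_wronskian_bound _ _ _ _ _ _ _ _ Hb SA SB HP HdP P0 P1 h)
    as Hle.
  destruct (odd_of_second_order b _ _ _ HP HdP
              (fun u => proj1 (sinh_odd _ _ _ u SA)) P0 h) as [OP EP].
  destruct (sinh_odd _ _ _ h SA) as [OA EA].
  destruct (sinh_odd _ _ _ h SB) as [OB _].
  pose proof (sinh_pos _ _ _ h SA Hh) as PA.
  pose proof (sinh_pos _ _ _ h SB Hh) as PB.
  rewrite OP, EP, OA, EA, OB.
  split; [|split; field; lra].
  unfold Rdiv; rewrite <- Rmult_assoc.
  apply Rmult_le_compat_r; [|apply Hle; lra].
  apply Rlt_le, Rinv_0_lt_compat; now apply Rmult_lt_0_compat.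
Qed.

Theorem theorem24 (a b : R) (ha : 0 <= a) (hb : 0 <= b)
  (n : nat) (hn : (3 <= n)%nat) (t : nat -> R)
  (ht : forall i k : nat, (1 <= i)%nat -> (i < k)%nat -> (k <= n)%nat -> t i < t k)
  (j : nat) (hj : (2 <= j)%nat) (hjn : (j <= n - 1)%nat) :
  Rmat a (- a) (- b) b t j (j - 1)%nat + Rmat a (- a) (- b) b t j (j + 1)%nat
  <= / 2 * Rmat a (- a) (- b) b t j j.
Proof.
  assert (Hl : 0 < t j - t (j - 1)%nat).
  { cut (t (j - 1)%nat < t j); [lra|apply ht; lia]. }
  assert (Hr : 0 < t (j + 1)%nat - t j).
  { cut (t j < t (j + 1)%nat); [lra|apply ht; lia]. }
  unfold Rmat; rewrite !Nat.eqb_refl.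
  replace (j - 1 =? j)%nat with false by (symmetry; apply Nat.eqb_neq; lia).
  replace (j - 1 =? j + 1)%nat with false by (symmetry; apply Nat.eqb_neq; lia).
  replace (j + 1 =? j)%nat with false by (symmetry; apply Nat.eqb_neq; lia).
  destruct (two_sigma_le_rho_and_odd a b _ hb Hl) as [Il [Ol _]].
  destruct (two_sigma_le_rho_and_odd a b _ hb Hr) as [Ir [_ Or]].
  rewrite Ol, Or; lra.
Qed.
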